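(* Let $\alpha=[a_1,a_2,\dots]\in(0,1)$ be irrational and let $r=r_{k_j}+R_1q_1+R_0$ for some $j\ge0$, where $R_1q_1+R_0<r_{k_{j+1}}-r_{k_j}$, $0\le R_1\le a_2+1$ and $0\le R_0<q_1$. (a) If $a_1$ is even, then $$0\le \max_{0\le n\le r}S_n(\alpha)-\Big(\max_{0\le m\le j(r)}S_m(\alpha_2)+\frac{a_1}{2}\Big)\le 1,\qquad \min_{0\le n\le r}S_n(\alpha)=\min_{0\le m\le j(r)}S_m(\alpha_2),$$ where $\alpha_2=[a_3,a_4,\dots]$ and $j(r)=\max\{j+\operatorname{sgn}(R_1)-1,\,0\}$. (b) If instead $a_1$ is odd, then $$0\le \max_{0\le n\le r}S_n(\alpha)-\Big(1-\min_{0\le m\le i(r)}S_m(\bar\alpha_1)+\frac{a_1-1}{2}\Big)\le 1,\qquad \min_{0\le n\le r}S_n(\alpha)=1-\max_{0\le m\le i(r)}S_m(\bar\alpha_1),$$ where $\bar\alpha_1=[a_2-1,a_3,\dots]$ and $i(r)=k_j-j+\max\{R_1-1,0\}$. Moreover, in the case $a_1$ even, the difference between maxima (the middle quantity in the first estimate of (a)) is equal to $1$ only if $R_1=0$ and $R_0\ge a_1/2$.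
   Context: Continued fractions: $[a_1,a_2,\dots]=1/(a_1+1/(a_2+\cdots))$ with positive integers $a_h$; $q_1=a_1$ is the denominator of the first convergent of $\alpha$. If $a_2=1$, $\bar\alpha_1=[a_2-1,a_3,\dots]$ is understood as $[a_4,a_5,\dots]$. $\{\cdot\}$ denotes the fractional part, and $\operatorname{sgn}(0)=0$, $\operatorname{sgn}(x)=1$ for $x>0$. For a real number $x$ put $S_n(x):=\sum_{r=0}^{n}s(rx)$, $n\ge0$, where $s(y):=2\chi_{[0,1/2)}(\{y\})-1$ and $\chi_A$ is the indicator function of $A$. For $k\ge0$ let $r_k:=\min\{r\ge0:\lfloor r\alpha\rfloor=k\}$ and $t_k:=\#\{r\ge0:\lfloor r\alpha\rfloor=k\}$; one has $t_k\in\{a_1,a_1+1\}$. Let $k_0<k_1<\cdots$ be the increasing enumeration of the $k\ge0$ with $t_k=a_1+1$ (so $k_0=0$, $r_{k_0}=0$). Consecutive gaps satisfy $r_{k_{j+1}}-r_{k_j}\in\{a_1a_2+1,\ a_1a_2+1+a_1\}$, and every integer $r\ge0$ has a unique representation $r=r_{k_j}+R_1q_1+R_0$ of the form described in the claim.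
   Formalization: The claim fails for small r (e.g. r=0, where S_0=1); the lower bound 0≤ in (a) is asserted for r≥a_1/2, the lower bound 0≤ in (b) for r+1≥(a_1-1)/2, and the min identity in (b) for r≥q_1, which are exactly the r for which they hold. *)

(* Defs.v *)
From HB Require Import structures.
From mathcomp Require Import all_boot all_order all_algebra finmap.
From mathcomp Require Import all_classical all_reals all_analysis.

Set Implicit Arguments.
Unset Strict Implicit.
Unset Printing Implicit Defensive.

Import Order.TTheory GRing.Theory Num.Theory.
Import numFieldNormedType.Exports.

Local Open Scope classical_set_scope.
Local Open Scope ring_scope.

(** Continued fractions.  [cfrac_trunc u n] is the finite continued fraction
    [[u 0, ..., u n.-1]], and [cfrac u] is the infinite one. *)
Fixpoint cfrac_trunc (R : realType) (u : nat -> nat) (n : nat) : R :=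
  if n is m.+1 then ((u 0%N)%:R + cfrac_trunc R (fun h => u h.+1) m)^-1 else 0.

Definition cfrac (R : realType) (u : nat -> nat) : R :=
  lim (cfrac_trunc R u n @[n --> \oo]).

(** Partial quotients [a_1, a_2, ...] are the values [a 1, a 2, ...];
    [a 0] is never used. *)
Definition cf_alpha (R : realType) (a : nat -> nat) : R :=
  cfrac R (fun h => a h.+1).

Definition cf_alpha2 (R : realType) (a : nat -> nat) : R :=
  cfrac R (fun h => a h.+3).

(** [[a_2 - 1, a_3, ...]], to be read as [[a_4, a_5, ...]] when [a_2 = 1]. *)
Definition cf_alphabar1 (R : realType) (a : nat -> nat) : R :=
  if a 2%N == 1%N then cfrac R (fun h => a h.+4)
  else cfrac R (fun h => if h is 0 then (a 2%N).-1 else a h.+2).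

Definition frac_part (R : realType) (y : R) : R := y - (Num.floor y)%:~R.

Definition sq_wave (R : realType) (y : R) : int :=
  2 * (frac_part y \in `[0, 2^-1[)%:Z - 1.

Definition Ssum (R : realType) (n : nat) (x : R) : int :=
  \sum_(0 <= r < n.+1) sq_wave (r%:R * x).

(** The default value [Ssum 0 x] is one of the values ranged over, so it does not
    affect the extremum. *)
Definition maxS (R : realType) (r : nat) (x : R) : int :=
  \big[Num.max/Ssum 0 x]_(0 <= n < r.+1) Ssum n x.

Definition minS (R : realType) (r : nat) (x : R) : int :=
  \big[Num.min/Ssum 0 x]_(0 <= n < r.+1) Ssum n x.

(** The least element of a nonempty set ([0] if the set is empty). *)
Definition set_min (A : set nat) : nat :=
  xget 0%N [set m | A m /\ forall n, A n -> (m <= n)%N].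

Fixpoint increasing_enum (A : set nat) (j : nat) : nat :=
  if j is i.+1 then set_min (A `&` [set k | (increasing_enum A i < k)%N])
  else set_min A.

Definition floor_fiber (R : realType) (alpha : R) (k : nat) : set nat :=
  [set r | Num.floor (r%:R * alpha) = k%:Z].

Definition r_ (R : realType) (alpha : R) (k : nat) : nat :=
  set_min (floor_fiber alpha k).

Definition t_ (R : realType) (alpha : R) (k : nat) : nat :=
  #|` fset_set (floor_fiber alpha k)|.

Definition k_ (R : realType) (alpha : R) (a1 : nat) (j : nat) : nat :=
  increasing_enum [set k | t_ alpha k = a1.+1] j.

(** [max (j + sgn R1 - 1) 0] and [k_j - j + max (R1 - 1) 0]: truncated
    subtraction takes the place of [max _ 0], and [j <= k_j]. *)
Definition idx_even (j R1 : nat) : nat := (j + (0 < R1) - 1)%N.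

Definition idx_odd (R : realType) (alpha : R) (a1 j R1 : nat) : nat :=
  (k_ alpha a1 j - j + (R1 - 1))%N.

(* Main.v *)
Require Import Defs.
From HB Require Import structures.
From mathcomp Require Import all_boot all_order all_algebra finmap.
From mathcomp Require Import all_classical all_reals all_analysis.
From mathcomp Require Import zify ring lra.
Import Order.TTheory GRing.Theory Num.Theory.
Import numFieldNormedType.Exports.
Local Open Scope classical_set_scope.
Local Open Scope ring_scope.

(** Put [q = a 1] and [y = [a_2, a_3, ...]], so that [alpha = 1 / (q + y)],
    and let [c k] be the ceiling of [k y].  The [r] with
    [floor (r alpha) = k] form the fibre [p k <= r < p k.+1], where
    [p k = q k + c k] ([fibre_startP]); it has [q] or [q + 1] elements, and it
    is long exactly when [k] is the integer part of [j / y] with [j = c k],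
    so that this integer part is [k_j] ([k_E]).

    Along a fibre the wave [s (r alpha)] is first [1] and then [-1]
    ([sq_wave_fibre]): the graph of [S] is a chain of hills, one for each
    fibre, with sides of length about [b = q %/ 2].  So the minimum of [S] is
    reached in the valleys, and its maximum is [b] or [b + 1] above the highest
    valley ([hills_min], [hills_max_ge], [hills_max_le]).

    The heights of the valleys are again sums of the square wave.
    - If [q] is even, a short fibre has as many [1] as [-1], and the long fibre
      [k_j] has one extra term, equal to the wave at [j / y].  The valley at
      the start of fibre [k] is therefore the sum over [j < c k] of these
      waves ([fibre_total_even]), and [1 / y = a_2 + alpha_2].
    - If [q] is odd, long fibres cancel, and the [i]-th short fibre has total
      [- s (i beta)] with [beta = y / (1 - y)].  Since [k - c k] counts short
      fibres, the valley is [1 - S_(k - c k) (beta)] ([fibre_total_odd]), and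
      [beta] is an integer plus [[a_2 - 1, a_3, ...]] ([cf_alphabar1E]).

    The index of the valley sum moves by [0] or [1] from one fibre to the next,
    so the valleys met up to fibre [K] have the same extrema as the whole
    initial segment of valley sums ([run_max_slow], [run_min_slow]).  With
    [K = k_j + R1] the index is the one of the claim ([block_position],
    [carry_between]).  Only [K = 0], where no hill is complete, is computed
    apart ([first_fibre]). *)

(** * Convergence and recursion for continued fractions *)

Section ContinuedFractions.
Variable R : realType.
Implicit Types (u : nat -> nat) (x : R).

Lemma cfrac_trunc_itv u n : (forall h, (0 < u h)%N) ->
  0 <= cfrac_trunc R u n <= 1.
Proof.
elim: n u => [|n IH] u u0 /=; first by rewrite lexx ler01.
have /andP[x0 _] := IH (fun h => u h.+1) (fun h => u0 h.+1).
have u1 : (1 : R) <= (u 0)%:R by rewrite ler1n.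
have d1 : 1 <= (u 0)%:R + cfrac_trunc R (fun h => u h.+1) n by lra.
by rewrite invr_ge0 invf_le1; lra.
Qed.

(** One step [x |-> 1 / (a + x)] is not a uniform contraction on [[0, 1]]: for
    [a = 1] its slope at [0] is [-1].  Two steps form the homography
    [(b + x) / (a (b + x) + 1)], of determinant [1] and denominator at least
    [2]; hence the factor [1/4]. *)
Lemma cfrac_two_steps (a b x y : R) : 1 <= a -> 1 <= b -> 0 <= x -> 0 <= y ->
  `|(a + (b + x)^-1)^-1 - (a + (b + y)^-1)^-1| <= `|x - y| / 4.
Proof.
move=> a1 b1 x0 y0.
have X1 : 1 <= a * (b + x) by rewrite -[1]mul1r ler_pM //; lra.
have Y1 : 1 <= a * (b + y) by rewrite -[1]mul1r ler_pM //; lra.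
have -> : (a + (b + x)^-1)^-1 - (a + (b + y)^-1)^-1
    = (x - y) / ((a * (b + x) + 1) * (a * (b + y) + 1)).
  have bx : b + x != 0 by lra.
  have by_ : b + y != 0 by lra.
  have -> : a + (b + x)^-1 = (a * (b + x) + 1) / (b + x) by field.
  have -> : a + (b + y)^-1 = (a * (b + y) + 1) / (b + y) by field.
  by field; rewrite bx by_; apply/and3P; split; lra.
rewrite normrM ler_wpM2l // normfV lef_pV2 ?posrE //; first last.
- by rewrite normr_gt0 mulf_neq0; lra.
rewrite ger0_norm; last by rewrite mulr_ge0; lra.
by nra.
Qed.

(** Two truncations that share [2 N] partial quotients are within [4^-N] of
    each other.  The harmonic bound is weaker and enough for convergence. *)
Lemma cfrac_trunc_cauchy u N n m : (forall h, (0 < u h)%N) ->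
  `|cfrac_trunc R u (N.*2 + n) - cfrac_trunc R u (N.*2 + m)| <= N.+1%:R^-1.
Proof.
elim: N u => [|N IH] u u0.
  rewrite double0 !add0n invr1.
  have := cfrac_trunc_itv u n u0; have := cfrac_trunc_itv u m u0.
  by rewrite ler_norml => /andP[? ?] /andP[? ?]; apply/andP; split; lra.
rewrite doubleS !addSn /=.
set v := fun h => u h.+2.
have v0 h : (0 < v h)%N by exact: u0.
apply: (le_trans (cfrac_two_steps _ _ _ _ _ _ _ _)).
- by rewrite ler1n.
- by rewrite ler1n.
- by case/andP: (cfrac_trunc_itv v (N.*2 + n) v0).
- by case/andP: (cfrac_trunc_itv v (N.*2 + m) v0).
have zN := IH v v0.
have N1 : (1 : R) <= N.+1%:R by rewrite ler1n.
have e : N.+2%:R = N.+1%:R + 1 :> R by rewrite -natr1.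
apply: (@le_trans _ _ (N.+1%:R^-1 / 4)).
  by rewrite ler_pM2r; [exact: zN | lra].
move: N1 e; set w := _.+1%:R; set w' := _.+2%:R => w1 e.
by rewrite -invfM lef_pV2 ?posrE; lra.
Qed.

Lemma is_cvg_cfrac_trunc u : (forall h, (0 < u h)%N) ->
  cvgn (cfrac_trunc R u).
Proof.
move=> u0; apply/cauchy_cvgP/cauchy_exP => e e0.
have [N NP] : exists N, N.+1%:R^-1 < e.
  have [N _ NP] := near_infty_natSinv_lt (PosNum e0).
  by exists N; apply: (NP N) => /=.
exists (cfrac_trunc R u (N.*2 + 0)).
exists (N.*2) => // n /= Nn.
rewrite /ball /=.
by rewrite -(subnKC Nn) (le_lt_trans (cfrac_trunc_cauchy _ _ _ _ _)).
Qed.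

Lemma cfrac_itv u : (forall h, (0 < u h)%N) -> 0 <= cfrac R u <= 1.
Proof.
move=> u0; have c := is_cvg_cfrac_trunc u u0; apply/andP; split.
  by apply: limr_ge => //; apply: nearW => n; case/andP: (cfrac_trunc_itv u n u0).
by apply: limr_le => //; apply: nearW => n; case/andP: (cfrac_trunc_itv u n u0).
Qed.

Lemma cfracE u : (forall h, (0 < u h)%N) ->
  cfrac R u = ((u 0%N)%:R + cfrac R (fun h => u h.+1))^-1.
Proof.
move=> u0; set v := fun h => u h.+1.
have v0 h : (0 < v h)%N by exact: u0.
have /andP[x0 _] := cfrac_itv v v0.
have u1 : (1 : R) <= (u 0)%:R by rewrite ler1n.
apply: cvg_lim => //; rewrite -cvg_shiftS /=.
apply: cvgV; first by rewrite gt_eqF //; lra.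
by apply: cvgD; [exact: cvg_cst | exact: is_cvg_cfrac_trunc].
Qed.

Lemma rationalV x : rational x -> rational x^-1.
Proof. by case=> q _ <-; exists q^-1 => //; rewrite fmorphV. Qed.

Lemma rationalDn x n : rational x -> rational (n%:R + x).
Proof.
case=> q _ <-; exists (n%:R + q) => //.
by rewrite rmorphD /= ratr_nat.
Qed.

Lemma irrational_itv01 x : irrational x -> 0 <= x <= 1 -> 0 < x < 1.
Proof.
move=> xi /andP[x0 x1]; rewrite !lt_neqAle x0 x1 !andbT; apply/andP; split.
  by apply: contra_notN xi => /eqP <-; exists 0 => //; rewrite rmorph0.
by apply: contra_notN xi => /eqP ->; exists 1 => //; rewrite rmorph1.
Qed.

Lemma irrational_cfrac_tail u : (forall h, (0 < u h)%N) ->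
  irrational (cfrac R u) -> irrational (cfrac R (fun h => u h.+1)).
Proof.
by move=> u0; apply: contra_not => xq; rewrite cfracE //; apply/rationalV/rationalDn.
Qed.

Lemma irrational_neqMn x n m : irrational x -> n.+1%:R * x != m%:R.
Proof.
apply: contra_notN => /eqP e; exists (m%:R / n.+1%:R) => //.
by rewrite rmorphM fmorphV /= !ratr_nat -e mulrAC mulfV ?mul1r //.
Qed.
End ContinuedFractions.

(** * Running extrema *)

Section RunningExtrema.
Implicit Types (f g : nat -> int) (c : int).

(** The default values are chosen so that [maxS r x] and [minS r x] unfold to
    the running extrema of [m |-> Ssum m x]. *)
Definition run_max f (n : nat) : int := \big[Num.max/f 0%N]_(0 <= m < n.+1) f m.
Definition run_min f (n : nat) : int := \big[Num.min/f 0%N]_(0 <= m < n.+1) f m.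

Lemma le_run_max f n m : (m <= n)%N -> f m <= run_max f n.
Proof. by move=> mn; apply: le_bigmax_seq; rewrite ?mem_index_iota. Qed.

Lemma run_max_le f n c : (forall m, (m <= n)%N -> f m <= c) -> run_max f n <= c.
Proof.
move=> fc; rewrite /run_max big_seq; apply: bigmax_le; first exact: fc.
by move=> m; rewrite mem_index_iota => /andP[_ mn]; exact: fc.
Qed.

Lemma run_max_attained f n : exists2 m, (m <= n)%N & run_max f n = f m.
Proof.
rewrite /run_max big_seq; elim/big_ind: _ => [|x y [m mn ->] [m' mn' ->]|m].
- by exists 0%N.
- by case: leP => _; [exists m' | exists m].
- by rewrite mem_index_iota => /andP[_ mn]; exists m.
Qed.

Lemma run_max0 f : run_max f 0 = f 0%N.
Proof. by have [m] := run_max_attained f 0; rewrite leqn0 => /eqP -> ->. Qed.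

Lemma run_min_opp f n : run_min f n = - run_max (fun m => - f m) n.
Proof.
rewrite /run_min /run_max; elim/big_rec2: _ => [|m x y _ ->]; first by rewrite opprK.
by rewrite oppr_max opprK.
Qed.

Lemma eq_run_max f g n : (forall m, (m <= n)%N -> f m = g m) ->
  run_max f n = run_max g n.
Proof.
move=> fg; apply/eqP; rewrite eq_le; apply/andP; split; apply: run_max_le => m mn.
  by rewrite fg // le_run_max.
by rewrite -fg // le_run_max.
Qed.

Lemma run_max_addl f n c : run_max (fun m => c + f m) n = c + run_max f n.
Proof.
apply/eqP; rewrite eq_le; apply/andP; split.
  by apply: run_max_le => m mn; rewrite lerD2l le_run_max.
have [m mn ->] := run_max_attained f n.
exact: (le_run_max (fun m => c + f m)).
Qed.

Lemma run_min0 f : run_min f 0 = f 0%N.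
Proof. by rewrite run_min_opp run_max0 opprK. Qed.

Lemma run_min_const_sub f n c : run_min (fun m => c - f m) n = c - run_max f n.
Proof.
rewrite run_min_opp (eq_run_max _ (fun m => - c + f m)); last first.
  by move=> m _; rewrite opprB addrC.
by rewrite run_max_addl opprD opprK.
Qed.

Lemma run_max_const_sub f n c : run_max (fun m => c - f m) n = c - run_min f n.
Proof. by rewrite run_max_addl run_min_opp opprK. Qed.

Lemma le_run_min f n m : (m <= n)%N -> run_min f n <= f m.
Proof. by move=> mn; rewrite run_min_opp lerNl (le_run_max (fun m => - f m)). Qed.

Lemma run_min_ge f n c : (forall m, (m <= n)%N -> c <= f m) -> c <= run_min f n.
Proof.
move=> fc; rewrite run_min_opp lerNr; apply: run_max_le => m mn.
by rewrite lerN2 fc.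
Qed.

(** Discrete intermediate value theorem. *)
Lemma slow_attains (h : nat -> nat) K m : h 0%N = 0%N ->
  (forall k, (h k <= h k.+1 <= (h k).+1)%N) ->
  (m <= h K)%N -> exists2 k, (k <= K)%N & h k = m.
Proof.
move=> h0 hS; elim: K => [|K IH] mK; first by exists 0%N => //; lia.
have /orP[mK'|/eqP mK'] : (m <= h K)%N || (h K.+1 == m) by have := hS K; lia.
  by have [k kK <-] := IH mK'; exists k => //; lia.
by exists K.+1.
Qed.

(** A reindexing with steps [0] and [1] skips no index, so [f] and [g] take the
    same values on the corresponding initial segments. *)
Lemma run_max_slow (h : nat -> nat) f g K : h 0%N = 0%N ->
  (forall k, (h k <= h k.+1 <= (h k).+1)%N) ->
  (forall k, f k = g (h k)) ->
  run_max f K = run_max g (h K).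
Proof.
move=> h0 hS fg; apply/eqP; rewrite eq_le; apply/andP; split.
  apply: run_max_le => k kK; rewrite fg le_run_max //.
  elim: K kK => [|K IH] kK; first by have -> : k = 0%N by lia.
  by have := hS K; case: (ltngtP k K.+1) kK => // [/IH|->]; lia.
apply: run_max_le => m mK.
by have [k kK <-] := slow_attains h K m h0 hS mK; rewrite -fg le_run_max.
Qed.
Lemma run_min_slow (h : nat -> nat) f g K : h 0%N = 0%N ->
  (forall k, (h k <= h k.+1 <= (h k).+1)%N) ->
  (forall k, f k = g (h k)) ->
  run_min f K = run_min g (h K).
Proof.
move=> h0 hS fg; rewrite !run_min_opp; congr (- _).
by apply: run_max_slow => // k; rewrite fg.
Qed.
End RunningExtrema.

(** * Chains of hills

    A walk [P] with steps [s] climbs [u k] steps and descends [d k] steps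
    between the times [p k] and [p k.+1]; [V k] is its height in the valley
    that precedes hill [k]. *)

Section Hills.
Variables (s : nat -> int) (u d p : nat -> nat).
Hypothesis p0 : p 0%N = 0%N.
Hypothesis pS : forall k, p k.+1 = (p k + u k + d k)%N.
Hypothesis s_up : forall k x, (x < u k)%N -> s (p k + x)%N = 1.
Hypothesis s_down : forall k x, (u k <= x < u k + d k)%N -> s (p k + x)%N = -1.

Let P (n : nat) : int := \sum_(0 <= r < n) s r.
Let V (k : nat) : int := P (p k).

Lemma hill_up k x : (x <= u k)%N -> P (p k + x) = V k + x%:Z.
Proof.
elim: x => [|x IH] xu; first by rewrite addn0 addr0.
by rewrite addnS /P big_nat_recr //= -/(P _) IH ?s_up; lia.
Qed.

Lemma hill_down k x : (u k <= x <= u k + d k)%N ->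
  P (p k + x) = V k + (u k)%:Z *+ 2 - x%:Z.
Proof.
elim: x => [|x IH] xu.
  have u0 : u k = 0%N by lia.
  by rewrite addn0 /V u0; lia.
have [ux|] := leqP (u k) x; last first.
  move=> ux; have e : u k = x.+1 by lia.
  by rewrite hill_up; lia.
by rewrite addnS /P big_nat_recr //= -/(P _) IH ?s_down; lia.
Qed.

Lemma hill_end k : V k.+1 = V k + (u k)%:Z - (d k)%:Z.
Proof. by rewrite {1}/V pS -addnA hill_down; lia. Qed.

Lemma hill_value k n : (p k <= n <= p k.+1)%N ->
  (n - p k <= u k)%N /\ P n = V k + (n - p k)%:Z \/
  (u k <= n - p k <= u k + d k)%N /\ P n = V k + (u k)%:Z *+ 2 - (n - p k)%:Z.
Proof.
rewrite pS => /andP[pn np]; have [xu|ux] := leqP (n - p k) (u k).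
  by left; split=> //; rewrite -{1}(subnKC pn) hill_up.
have xd : (u k <= n - p k <= u k + d k)%N by lia.
by right; split=> //; rewrite -{1}(subnKC pn) hill_down.
Qed.

Lemma hill_le k n : (p k <= n <= p k.+1)%N -> P n <= V k + (u k)%:Z.
Proof.
by move=> /hill_value[] [] ? ->; lia.
Qed.

Lemma hill_le_start k n : (p k <= n <= p k.+1)%N -> P n <= V k + (n - p k)%:Z.
Proof.
by move=> /hill_value[] [] ? ->; lia.
Qed.

Lemma hill_ge k n : (p k <= n <= p k.+1)%N ->
  (V k <= P n) || (V k.+1 <= P n).
Proof.
by rewrite hill_end => /hill_value[] [] ? ->; lia.
Qed.

Lemma hill_ge_start k n : V k <= V k.+1 + 1 -> (p k <= n < p k.+1)%N -> V k <= P n.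
Proof.
rewrite hill_end => Vk kn; have kn' : (p k <= n <= p k.+1)%N by lia.
by have := pS k; have [[? ->]|[? ->]] := hill_value k n kn'; lia.
Qed.

(** Reading the descent backwards from its foot: the height is known as soon as
    a lower bound on [d k] is, whatever [u k]. *)
Lemma hill_before_end k x : (x <= d k)%N -> P (p k.+1 - x) = V k.+1 + x%:Z.
Proof.
move=> xd; rewrite hill_end pS.
have -> : (p k + u k + d k - x = p k + (u k + d k - x))%N by lia.
by rewrite hill_down; lia.
Qed.

Lemma hill_locate K n : (n < p K)%N -> exists2 k, (k < K)%N & (p k <= n < p k.+1)%N.
Proof.
elim: K => [|K IH] nK; first by rewrite p0 in nK.
have [/IH[k kK kn]|Kn] := ltnP n (p K); first by exists k => //; lia.
by exists K => //; rewrite Kn.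
Qed.

Lemma p_mono k l : (k <= l)%N -> (p k <= p l)%N.
Proof.
by move=> /subnKC <-; elim: (l - k)%N => [|m IH]; rewrite ?addn0 // addnS pS; lia.
Qed.

(** The walk is stopped during hill [K.+1], which is left unfinished: time
    [p K.+2] is not reached.  Valley [0] is the start of the walk and the
    extrema below range over the valleys [1, ..., K.+1] that end a hill;
    [V1] says how valley [0], of height [0], compares with valley [1]. *)
Variables (b K N : nat).
Hypothesis d_ge : forall k, (b <= d k)%N.
Hypothesis ud_gt : forall k, (b < u k + d k)%N.
Hypothesis u_le : forall k, (u k <= b.+1)%N.
Hypothesis V1 : 0 <= V 1 <= 1.
Hypothesis NK : (p K.+1 <= N.+1 < p K.+2)%N.

Let A := run_max (fun k => V k.+1) K.
Let B := run_min (fun k => V k.+1) K.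

Lemma V_le_run_max k : (k <= K.+1)%N -> V k <= A.
Proof.
have hV k' : (k' <= K)%N -> V k'.+1 <= A by exact: (le_run_max (fun k => V k.+1)).
case: k => [|k] kK; last exact: hV.
have -> : V 0 = 0 by rewrite /V p0 /P big_geq.
by apply: (@le_trans _ _ (V 1)); [case/andP: V1 | exact: hV].
Qed.

(** Each descent has length at least [b], so the point [b] steps before the foot
    of a hill is [b] higher than this foot. *)
Lemma hills_max_ge : A + b%:Z <= run_max (fun n => P n.+1) N.
Proof.
rewrite /A; have [k kK ->] := run_max_attained (fun k => V k.+1) K.
rewrite -hill_before_end //.
have p1 : (b < p k.+1)%N by rewrite pS; have := ud_gt k; lia.
have -> : (p k.+1 - b = (p k.+1 - b).-1.+1)%N by lia.
apply: (le_run_max (fun n => P n.+1)).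
have : (p k.+1 <= p K.+1)%N by exact: p_mono.
lia.
Qed.

Lemma hills_max_le : run_max (fun n => P n.+1) N <= A + b%:Z + 1.
Proof.
apply: run_max_le => n nN.
have [k kK kn] : exists2 k, (k < K.+2)%N & (p k <= n.+1 < p k.+1)%N.
  by apply: hill_locate; lia.
have := hill_le k n.+1; have := V_le_run_max k; have := u_le k; lia.
Qed.

(** When every summit is at most [b] above the higher of its two feet, a finished
    hill cannot exceed [A + b].  The unfinished hill, whose right foot does not
    count in [A], can do so only after more than [b] upward steps. *)
Lemma hills_max_eq :
  (forall k, (u k <= b)%N || (V k + (u k)%:Z <= V k.+1 + b%:Z)) ->
  (N.+1 - p K.+1 <= b)%N || (u K.+1 <= b)%N ->
  run_max (fun n => P n.+1) N = A + b%:Z.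
Proof.
move=> top last_hill; apply/eqP; rewrite eq_le hills_max_ge andbT.
apply: run_max_le => n nN.
have [k kK kn] : exists2 k, (k < K.+2)%N & (p k <= n.+1 < p k.+1)%N.
  by apply: hill_locate; lia.
have [kK'|kK'] := leqP k K.
  have := hill_le k n.+1; have := top k.
  have := V_le_run_max k; have := V_le_run_max k.+1; lia.
have {kK kK'} kK : k = K.+1 by lia.
move: kn; rewrite kK => kn.
have := hill_le K.+1 n.+1; have := hill_le_start K.+1 n.+1.
have := V_le_run_max K.+1; lia.
Qed.

(** A finished hill stays above the lower of its feet.  The unfinished one lacks
    at least its last downward step; as its right foot would be at most one
    below the left one, it stays above the left foot. *)
Lemma hills_min : V K.+1 <= V K.+2 + 1 -> run_min (fun n => P n.+1) N = B.
Proof.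
move=> VK.
have BV k : (k <= K)%N -> B <= V k.+1.
  move=> kK; rewrite /B run_min_opp.
  by have := le_run_max (fun k => - V k.+1) K k kK; lia.
apply/eqP; rewrite eq_le; apply/andP; split.
  rewrite /B 2!run_min_opp lerN2.
  have [k kK ->] := run_max_attained (fun k => - V k.+1) K.
  have p1 : (0 < p k.+1)%N by rewrite pS; have := ud_gt k; lia.
  have -> : V k.+1 = P (p k.+1).-1.+1 by rewrite prednK.
  apply: (le_run_max (fun n => - P n.+1)).
  have : (p k.+1 <= p K.+1)%N by exact: p_mono.
  lia.
rewrite run_min_opp lerNr; apply: run_max_le => n nN; rewrite lerN2.
have [[|k] kK kn] : exists2 k, (k < K.+2)%N & (p k <= n.+1 < p k.+1)%N.
  by apply: hill_locate; lia.
(* On hill 0 the left foot, at time 0, is not among the times n.+1 >= 1: there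
   the walk has height at least 1 >= V 1 while it climbs, and descends to V 1
   afterwards. *)
- have := BV 0%N isT; have := hill_end 0; move: kn; rewrite pS p0 !add0n => kn.
  have V0 : V 0 = 0 by rewrite /V p0 /P big_geq.
  have := hill_up 0 n.+1; have := hill_down 0 n.+1; rewrite p0 !add0n V0.
  move: V1; case: (leqP n.+1 (u 0)) => h; lia.
- have [kK'|kK'] := ltnP k K.
    have := BV k (ltnW kK'); have := BV k.+1 kK'.
    have := hill_ge k.+1 n.+1; lia.
  have {kK kK'} kK : k = K by lia.
  move: kn; rewrite kK => kn.
  have := BV K (leqnn K); have := hill_ge_start K.+1 n.+1 VK kn; lia.
Qed.

End Hills.

(** * The square wave and its sums *)

Section SquareWave.
Variable R : realType.
Implicit Types (x z : R).

Lemma sq_waveE z (m : int) : m%:~R <= z < (m + 1)%:~R ->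
  sq_wave z = if z < m%:~R + 2^-1 then 1 else -1.
Proof.
move=> mz; rewrite /sq_wave /frac_part (floor_def mz) in_itv /=.
move: mz => /andP[mz _].
have -> : 0 <= z - m%:~R by lra.
have -> : (z - m%:~R < 2^-1) = (z < m%:~R + 2^-1) by rewrite ltrBlDl.
by case: ifP.
Qed.

Lemma sq_waveDn z (n : nat) : sq_wave (z + n%:R) = sq_wave z.
Proof.
rewrite /sq_wave /frac_part floorDrz ?rpred_nat //.
have -> : Num.floor (n%:R : R) = n%:Z by exact: (intrKfloor n%:Z).
have e : z + n%:R - (Num.floor z + n%:Z)%:~R = z - (Num.floor z)%:~R.
  by rewrite intrD; ring.
by rewrite e.
Qed.

Lemma Ssum_shift n x (m : nat) : Ssum n (m%:R + x) = Ssum n x.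
Proof.
apply: eq_bigr => r _.
by rewrite mulrDr -natrM addrC sq_waveDn.
Qed.

Lemma SsumS n x : Ssum n.+1 x = Ssum n x + sq_wave (n.+1%:R * x).
Proof. by rewrite /Ssum big_nat_recr. Qed.

Lemma Ssum0 x : Ssum 0 x = 1.
Proof.
rewrite /Ssum big_nat1 mul0r (@sq_waveE 0 0); last by rewrite lexx ltr01.
by rewrite add0r invr_gt0 ltr0n.
Qed.
End SquareWave.

(** * Fibres of the integer part along multiples of alpha *)

Section Fibres.
Variables (R : realType) (q : nat) (y : R).
Hypothesis q0 : (0 < q)%N.
Hypotheses (y_gt0 : 0 < y) (y_lt1 : y < 1).

Local Ltac ylra := have ? := y_gt0; have ? := y_lt1; lra.

Let alpha : R := (q%:R + y)^-1.

Definition carry (k : nat) : nat := `|Num.ceil (k%:R * y)|%N.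
Definition fibre_start (k : nat) : nat := (q * k + carry k)%N.
(** Fibre [k] is long when [k y <= j < (k + 1) y] for some integer [j], that is,
    when [k] is the integer part of [j / y]. *)
Definition long_fibre (j : nat) : nat := Num.trunc (j%:R / y).

Local Notation c := carry.
Local Notation p := fibre_start.
Local Notation K := long_fibre.

Lemma carry_le k n : (c k <= n)%N = (k%:R * y <= n%:R :> R).
Proof.
have ky : 0 <= k%:R * y by rewrite mulr_ge0 ?ler0n ?ltW.
have k0 : 0 <= Num.ceil (k%:R * y) by rewrite ceil_ge0; ylra.
by rewrite -lez_nat /c (gez0_abs k0) ceil_le_int.
Qed.

Lemma carry_gt k n : (n < c k)%N = (n%:R < k%:R * y :> R).
Proof. by rewrite ltnNge carry_le -ltNge. Qed.

Lemma carry0 : c 0 = 0%N.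
Proof. by apply/eqP; rewrite -leqn0 carry_le mul0r. Qed.

Lemma carry_step k : (c k <= c k.+1 <= (c k).+1)%N.
Proof.
have := leqnn (c k.+1); rewrite carry_le -natr1 => h.
have := leqnn (c k); rewrite carry_le => h'.
by apply/andP; split; rewrite carry_le; [|rewrite -!natr1]; ylra.
Qed.

Lemma carry_mono k l : (k <= l)%N -> (c k <= c l)%N.
Proof.
move=> /subnKC <-; elim: (l - k)%N => [|m IH]; rewrite ?addn0 // addnS.
by have := carry_step (k + m); lia.
Qed.

Lemma carry1 : c 1 = 1%N.
Proof.
have := carry_step 0; have : (0 < c 1)%N by rewrite carry_gt mul1r; ylra.
by rewrite carry0; lia.
Qed.

Lemma carry_sub_step k : (k - c k <= k.+1 - c k.+1 <= (k - c k).+1)%N.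
Proof. by have := carry_step k; lia. Qed.

Lemma carry_leq k : (c k <= k)%N.
Proof. by rewrite carry_le ler_piMr ?ler0n //; ylra. Qed.

(** [k / alpha = k q + k y], and [p k] is the ceiling of this number. *)
Lemma fibre_startP k r : (p k <= r)%N = (k%:R <= r%:R * alpha :> R).
Proof.
have qy : 0 < q%:R + y by have : (0 : R) <= q%:R by []; ylra.
rewrite ler_pdivlMr // mulrDr -natrM.
have ky : 0 <= k%:R * y by rewrite mulr_ge0 //; ylra.
have [kr|rk] := leqP (k * q) r.
  have -> : (p k <= r)%N = (c k <= r - k * q)%N by rewrite /p; lia.
  by rewrite carry_le natrB //; apply/idP/idP; ylra.
have -> : (p k <= r)%N = false by rewrite /p; lia.
have : r%:R < (k * q)%:R :> R by rewrite ltr_nat.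
by move=> h; apply/esym/negbTE; rewrite -ltNge; ylra.
Qed.

Lemma floor_fibreP k r :
  (Num.floor (r%:R * alpha) = k%:Z) <-> (p k <= r < p k.+1)%N.
Proof.
rewrite ltnNge !fibre_startP -ltNge -natr1.
split=> [/eqP|h]; last apply/eqP; by rewrite floor_eq intrD.
Qed.

Lemma fibre_start0 : p 0 = 0%N.
Proof. by rewrite /p carry0 muln0. Qed.

Lemma fibre_start_lt k : (p k < p k.+1)%N.
Proof. by have := carry_step k; rewrite /p; lia. Qed.

Lemma set_minE (A : set nat) m :
  A m -> (forall n, A n -> (m <= n)%N) -> set_min A = m.
Proof.
move=> Am mA; apply: xget_unique => // n [An nA].
by have := mA n An; have := nA m Am; lia.
Qed.

Lemma r_E k : r_ alpha k = p k.
Proof.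
apply: set_minE => [|n]; rewrite /floor_fiber /=.
  by apply/floor_fibreP; rewrite leqnn fibre_start_lt.
by move/floor_fibreP => /andP[].
Qed.

Lemma t_E k : t_ alpha k = (p k.+1 - p k)%N.
Proof.
apply: card_fset_set.
have -> : floor_fiber alpha k = addn (p k) @` `I_(p k.+1 - p k).
  apply/seteqP; split=> r /=.
    move/floor_fibreP => h; exists (r - p k)%N; rewrite /=; lia.
  by move=> [x xk <-]; apply/floor_fibreP; rewrite /= in xk; lia.
by apply: inj_card_eq => x x' _ _; exact: addnI.
Qed.

Lemma long_fibreP j k : (k <= K j)%N = (k%:R * y <= j%:R :> R).
Proof.
have j0 : 0 <= j%:R / y by rewrite divr_ge0 ?ler0n //; ylra.
by rewrite truncn_ge_nat // ler_pdivlMr //; ylra.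
Qed.

(** [K] and [c] are adjoint: both sides say [k y <= j].  The position of the long
    fibres follows from this and from the steps of [c], by counting only. *)
Lemma carry_long_le k j : (k <= K j)%N = (c k <= j)%N.
Proof. by rewrite long_fibreP carry_le. Qed.

Lemma carry_long j : c (K j) = j.
Proof.
have h1 := carry_long_le (K j) j; have h2 := carry_long_le (K j).+1 j.
by have := carry_step (K j); lia.
Qed.

Lemma carry_after_long j : c (K j).+1 = j.+1.
Proof.
have h2 := carry_long_le (K j).+1 j.
by have := carry_step (K j); rewrite carry_long; lia.
Qed.

Lemma long_fibre_iff k : (c k.+1 = (c k).+1) <-> k = K (c k).
Proof.
have h1 := carry_long_le k (c k); have h2 := carry_long_le k.+1 (c k).
by have := carry_step k; split; lia.
Qed.

Lemma long_fibre_lt j : (K j < K j.+1)%N.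
Proof. by rewrite carry_long_le carry_after_long. Qed.

Lemma long_fibre0 : K 0 = 0%N.
Proof. by have := carry_long_le 1 0; rewrite carry1; lia. Qed.

Lemma carry_between j R1 : (K j + R1 <= K j.+1)%N ->
  c (K j + R1) = (j + (0 < R1))%N.
Proof.
case: R1 => [|R1] h; first by rewrite !addn0 carry_long.
have := carry_mono (K j).+1 (K j + R1.+1); have := carry_mono _ _ h.
by rewrite carry_long carry_after_long; lia.
Qed.

(** No long fibre lies strictly between [K j] and [K j.+1]: its index is [K l]
    with [l] its carry, and beyond [K j] the carry is at least [j.+1]. *)
Lemma k_E j : k_ alpha q j = K j.
Proof.
have tP k : t_ alpha k = q.+1 <-> k = K (c k).
  rewrite -long_fibre_iff t_E /p.
  by have := carry_step k; split; lia.
rewrite /k_; elim: j => [|j IH] /=.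
  rewrite long_fibre0; apply: set_minE => // /=.
  by apply/tP; rewrite carry0 long_fibre0.
rewrite IH; apply: set_minE.
  by split => /=; [apply/tP; rewrite carry_long | exact: long_fibre_lt].
move=> k [/= /tP kE]; rewrite kE.
by rewrite !carry_long_le carry_after_long carry_long.
Qed.

(** The fibre [k] starts at [q k + c k] and the wave changes sign at
    [(k + 1/2) / alpha = q k + q./2 + odd q / 2 + (k + 1/2) y].  As the last two
    terms differ from [c k] by at most [1], the number of [1] in the
    fibre is [q./2] or [q./2 + 1], according to this comparison. *)
Definition early_half (k : nat) : bool :=
  (c k)%:R < (odd q)%:R / 2 + (k%:R + 2^-1) * y.
Definition ups (k : nat) : nat := (q./2 + early_half k)%N.
Definition downs (k : nat) : nat := (p k.+1 - p k - ups k)%N.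

Lemma early_half_short k : ~~ odd q -> c k.+1 = c k -> early_half k = false.
Proof.
move=> /negbTE qe ck; rewrite /early_half qe; apply/negbTE; rewrite -leNgt mul0r add0r.
by have := leqnn (c k.+1); rewrite {2}ck carry_le -natr1; ylra.
Qed.

Lemma early_half_long k : odd q -> c k.+1 = (c k).+1 -> early_half k.
Proof.
move=> qo ck; rewrite /early_half qo mulr1n.
have := leqnn (c k.+1); rewrite {1}ck carry_gt -natr1; ylra.
Qed.

Lemma early_half_leq k : (early_half k <= odd q + (c k.+1 - c k))%N.
Proof.
have := carry_step k; have := early_half_short k.
by case: (odd q) (early_half k) => [] [] //= h; lia.
Qed.

Lemma ups_downs k : (ups k + downs k = q + (c k.+1 - c k))%N.
Proof.
have := early_half_leq k; have := carry_step k; have := odd_double_half q.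
rewrite /downs /ups /p; lia.
Qed.

Lemma fibre_startS k : p k.+1 = (p k + ups k + downs k)%N.
Proof. by have := ups_downs k; have := carry_step k; rewrite /p; lia. Qed.

(** After multiplication by [1 / alpha = q + y], the sign of the wave compares
    [c k + x] with [q./2 + e], where [c k - 1 < e <= c k + 1]. *)
Lemma sq_wave_fibre k x : (x < ups k + downs k)%N ->
  sq_wave ((p k + x)%:R * alpha) = if (x < ups k)%N then 1 else -1.
Proof.
move=> xk.
have /floor_fibreP/eqP : (p k <= p k + x < p k.+1)%N by rewrite fibre_startS; lia.
rewrite floor_eq => h; rewrite (sq_waveE _ _ _ h); congr (if _ then _ else _).
have qy : 0 < q%:R + y by have : (0 : R) <= q%:R by []; ylra.
have -> : ((p k + x)%:R * alpha < k%:R + 2^-1 :> R)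
    = ((c k)%:R + x%:R < (q./2)%:R + ((odd q)%:R / 2 + (k%:R + 2^-1) * y)).
  rewrite ltr_pdivrMr // /p !natrD natrM.
  have -> : q%:R = (odd q)%:R + (q./2)%:R * 2 :> R.
    by rewrite -natrM -natrD muln2 odd_double_half.
  by apply/idP/idP; lra.
have := leqnn (c k); rewrite {1}carry_le => h1.
have h2 : (c k)%:R < k%:R * y + 1.
  case: (c k) (carry_gt k) => [|m] e.
    by rewrite (lt_le_trans ltr01) // lerDr mulr_ge0 //; ylra.
  by have := ltnSn m; rewrite e -natr1; ylra.
have [half0 half1] : (0 : R) <= (odd q)%:R / 2 /\ (odd q)%:R / 2 <= 2^-1 :> R.
  by case: (odd q); rewrite ?mul0r ?mulr1n; split; lra.
rewrite /ups; set e := _ + _ * y.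
have [e1 e2] : k%:R * y < e /\ e < k%:R * y + 1.
  by rewrite /e; split; ylra.
rewrite /early_half -/e; have [ce|ec] := ltP (c k)%:R e; apply/idP/idP => H.
- rewrite ltnNge; apply/negP; rewrite addn1 => bx.
  have : (q./2)%:R + 1 <= x%:R :> R by rewrite natr1 ler_nat.
  ylra.
- have : x%:R <= (q./2)%:R :> R by rewrite ler_nat; rewrite addn1 ltnS in H.
  ylra.
- rewrite ltnNge; apply/negP; rewrite addn0 => bx.
  have : (q./2)%:R <= x%:R :> R by rewrite ler_nat.
  ylra.
- have : x%:R + 1 <= (q./2)%:R :> R by rewrite natr1 ler_nat; rewrite addn0 in H.
  ylra.
Qed.

Let s (r : nat) : int := sq_wave (r%:R * alpha).
Let V (k : nat) : int := \sum_(0 <= r < p k) s r.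

Lemma fibre_up k x : (x < ups k)%N -> s (p k + x) = 1.
Proof. by move=> xu; rewrite /s sq_wave_fibre ?xu //; lia. Qed.

Lemma fibre_down k x : (ups k <= x < ups k + downs k)%N -> s (p k + x) = -1.
Proof.
by move=> /andP[ux xd]; rewrite /s sq_wave_fibre // ltnNge ux.
Qed.

Lemma fibre_total k :
  V k.+1 = V k + (early_half k)%:Z *+ 2 - (odd q)%:Z - (c k.+1 - c k)%:Z.
Proof.
have := hill_end s ups downs p fibre_start0 fibre_startS fibre_up fibre_down k.
have := ups_downs k; have := odd_double_half q.
rewrite -/(V k) -/(V k.+1) /ups => h1 h2 ->.
lia.
Qed.

(** A long fibre with [j = c k] satisfies [k y <= j < (k + 1) y], hence [j / y]
    has integer part [k], and [j / y < k + 1/2] is the condition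
    [early_half k] for an extra [1]. *)
Lemma fibre_total_even k : ~~ odd q ->
  V k = \sum_(0 <= l < c k) sq_wave (l%:R * y^-1).
Proof.
move=> qe; elim: k => [|k IH]; first by rewrite /V /p carry0 muln0 !big_geq.
rewrite fibre_total (negbTE qe) IH.
have [ck|ck] : c k.+1 = c k \/ c k.+1 = (c k).+1 by have := carry_step k; lia.
  by rewrite early_half_short // ck; lia.
rewrite ck big_nat_recr //= (sq_waveE _ _ k); last first.
  have := leqnn (c k.+1); rewrite {1}ck carry_gt => h2.
  have := leqnn (c k); rewrite carry_le => h1.
  rewrite intrD -[k%:Z%:~R]/(k%:R) ler_pdivlMr ?y_gt0 // ltr_pdivrMr ?y_gt0 //.
  by rewrite h1 -[1%:~R]/(1 : R) natr1 h2.
rewrite ltr_pdivrMr ?y_gt0 // /early_half (negbTE qe) mul0r add0r.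
rewrite -[k%:Z%:~R]/(k%:R : R) subSnn.
rewrite -!addrA; congr (_ + _).
by case: ((c k)%:R < _).
Qed.

Hypothesis y_irr : irrational y.

(** In a short fibre put [i = k + 1 - c k], its rank among short fibres.  The
    inequalities [c k - 1 < k y] and [(k + 1) y < c k] say that
    [i y / (1 - y)] has integer part [c k - 1], and its fractional part is at
    least [1/2] exactly when [(k + 1/2) y >= c k - 1/2]: up to equality, which
    irrationality excludes, this is [early_half k]. *)
Lemma fibre_total_odd k : odd q ->
  V k = 1 - Ssum (k - c k) (y / (1 - y)).
Proof.
move=> qo; elim: k => [|k IH].
  by rewrite sub0n Ssum0 /V /p carry0 muln0 big_geq // subrr.
rewrite fibre_total qo IH.
have [ck|ck] : c k.+1 = c k \/ c k.+1 = (c k).+1 by have := carry_step k; lia.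
  have ckk := carry_leq k.
  have c0 : (0 < c k)%N by rewrite -ck carry_gt mulr_gt0.
  rewrite ck subSn // SsumS.
  have i1 : ((k - c k).+1)%:R = k%:R + 1 - (c k)%:R :> R by rewrite -natr1 natrB //; lra.
  have y1 : 0 < 1 - y by ylra.
  have c1 : ((c k).-1)%:R = (c k)%:R - 1 :> R by rewrite -{2}(prednK c0) -natr1 addrK.
  have := leqnn (c k.+1); rewrite {2}ck carry_le -natr1 le_eqVlt natr1.
  rewrite (negbTE (irrational_neqMn _ _ _ _ y_irr)) /= -natr1 => h2.
  have h1 : (c k)%:R - 1 < k%:R * y by rewrite -c1 -carry_gt; lia.
  rewrite mulrA (sq_waveE _ _ (c k).-1); last first.
    rewrite intrD -[(c k).-1%:Z%:~R]/((c k).-1%:R) -[1%:~R]/(1 : R) c1 i1.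
    by rewrite ler_pdivlMr // ltr_pdivrMr //; apply/andP; split; ylra.
  have -> : (((k - c k).+1)%:R * y / (1 - y) < ((c k).-1%:Z)%:~R + 2^-1)
      = ~~ early_half k.
    rewrite -[(c k).-1%:Z%:~R]/((c k).-1%:R : R) c1 i1 ltr_pdivrMr //.
    rewrite /early_half qo -leNgt.
    rewrite [RHS]le_eqVlt.
    have -> : (1%:R / 2 + (k%:R + 2^-1) * y == (c k)%:R) = false.
      have := irrational_neqMn _ y (2 * k) (2 * c k - 1) y_irr.
      rewrite -natr1 natrB ?natrM; last by lia.
      by move=> /eqP H; apply/eqP => H'; apply: H; lra.
    by rewrite /=; apply/idP/idP; lra.
  set t := Ssum _ _; rewrite subnn.
  by case: (early_half k) => /=; lia.
rewrite early_half_long // ck.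
have -> : (k.+1 - (c k).+1 = k - c k)%N by lia.
by set t := Ssum _ _; rewrite subSnn; lia.
Qed.

Lemma ups_le k : (ups k <= q./2.+1)%N.
Proof. by rewrite /ups; case: (early_half k); lia. Qed.

Lemma downs_ge k : (q./2 <= downs k)%N.
Proof.
have := ups_downs k; have := early_half_leq k; have := odd_double_half q.
rewrite /ups; lia.
Qed.

Lemma fibre_length_gt k : (q./2 < ups k + downs k)%N.
Proof. by rewrite ups_downs; have := odd_double_half q; lia. Qed.

(** The total of a fibre has the parity of its size: it is [0] for an even size,
    and [1] or [-1] for an odd one. *)
Lemma fibre_total_ge k : V k <= V k.+1 + 1.
Proof.
rewrite fibre_total; have := carry_step k.
have := early_half_long k.
case: (c k.+1 =P (c k).+1) => [->|]; first case: (odd q) => [->|_] //.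
all: by rewrite ?subSnn; lia.
Qed.

(** The walk at time [r.+1] is on hill [K j + R1].  A long fibre has one element
    more than [R1 = 1] accounts for, hence the offset [R1 == 0]: for [R1 = 0]
    the walk has made [R0 + 1] steps on the hill of the long fibre [K j], and
    for [R1 > 0] it has made [R0] steps on a later hill, which is short unless
    it is the next long one and [R0 = 0]. *)
Lemma block_position j R1 R0 :
  (R1 * q + R0 < p (K j.+1) - p (K j))%N -> (R0 < q)%N ->
  let k := (K j + R1)%N in let r := (p (K j) + R1 * q + R0)%N in
  [/\ (k <= K j.+1)%N, (p k <= r.+1 < p k.+1)%N,
      (r.+1 - p k = R0 + (R1 == 0))%N
    & (0 < R1)%N -> (0 < R0)%N -> c k.+1 = c k].
Proof.
rewrite {1 2}/p !carry_long => gap R0q k r.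
have kK : (k <= K j.+1)%N by rewrite /k; have := long_fibre_lt j; nia.
have ck : c k = (j + (0 < R1))%N by exact: carry_between.
have pk : p k = (q * K j + R1 * q + j + (0 < R1))%N by rewrite /p ck /k; lia.
have pkS : (p k + q + (R1 == 0) <= p k.+1)%N.
  have := carry_step k; rewrite /p; case: (R1 =P 0%N) => [R1z|]; last by lia.
  by rewrite /k R1z addn0 carry_after_long carry_long; lia.
have e : r.+1 = (p k + (R0 + (R1 == 0)))%N.
  by rewrite pk /r /p carry_long; case: (R1) => [|?] /=; lia.
split => //; rewrite ?e.
- by case: (R1 == 0%N) pkS; lia.
- by rewrite addKn.
move=> R1p R0p.
have kS : (K j + R1.+1 <= K j.+1)%N.
  by move: gap; rewrite /k in kK *; have := long_fibre_lt j; nia.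
by have := carry_between _ _ kS; rewrite ck addnS R1p => ->.
Qed.

Lemma ups0 : ups 0 = q./2.+1.
Proof.
rewrite /ups; suff -> : early_half 0 by rewrite addn1.
have : (0 : R) <= (odd q)%:R / 2 by rewrite divr_ge0.
by rewrite /early_half carry0; ylra.
Qed.

(** The first hill, before any valley has been reached. *)
Lemma first_fibre n : (n < q)%N ->
  Ssum n alpha = if (n <= q./2)%N then n.+1%:Z else (q./2).+1%:Z *+ 2 - n.+1%:Z.
Proof.
have z : \sum_(0 <= r < 0) s r = 0 :> int by rewrite big_geq.
move=> nq; have := hill_value s ups downs p fibre_start0 fibre_startS
  fibre_up fibre_down 0 n.+1.
rewrite fibre_startS fibre_start0 !add0n subn0 ups_downs ups0 z !add0r -/(Ssum n alpha).
move=> /(_ _)[|[nb ->]|[nb ->]]; first by lia.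
  by rewrite -ltnS nb.
by case: leqP => h //; lia.
Qed.

(** Case [q] even, with [alpha_2] replaced by [y^-1], which differs from it by an
    integer. *)
Lemma rotation_even j R1 R0 (r := (p (K j) + R1 * q + R0)%N) :
  ~~ odd q ->
  (R1 * q + R0 < p (K j.+1) - p (K j))%N -> (R0 < q)%N ->
  let i := idx_even j R1 in
  let D := maxS r alpha - (maxS i y^-1 + (q %/ 2)%:Z) in
  [/\ (q %/ 2 <= r)%N -> 0 <= D, D <= 1, minS r alpha = minS i y^-1
    & D = 1 -> R1 = 0%N /\ (q %/ 2 <= R0)%N].
Proof.
move=> qe gap R0q i D.
have [kK pos pos' short] := block_position j R1 R0 gap R0q.
rewrite -/r in pos pos'.
have Dge : forall m, (m <= r)%N -> Ssum m alpha <= maxS r alpha.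
  exact: (le_run_max (fun n => Ssum n alpha)).
have qq := odd_double_half q; rewrite (negbTE qe) add0n in qq.
have q2 : (q %/ 2 = q./2)%N by rewrite divn2.
case ek : (K j + R1)%N => [|k0].
  have [Kj R10] : K j = 0%N /\ R1 = 0%N by lia.
  have j0 : j = 0%N by rewrite -(carry_long j) Kj carry0.
  have i0 : i = 0%N by rewrite /i /idx_even j0 R10.
  have rR0 : r = R0 by rewrite /r Kj R10 fibre_start0.
  rewrite /D i0 -[maxS 0 _]/(run_max (fun n => Ssum n y^-1) 0).
  rewrite -[minS 0 _]/(run_min (fun n => Ssum n y^-1) 0).
  rewrite run_max0 run_min0 Ssum0 q2.
  have rle : maxS r alpha <= (q./2).+1%:Z.
    apply: run_max_le => n nr; rewrite first_fibre; last by lia.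
    by case: leqP => h; lia.
  split.
  - by move=> /Dge; rewrite first_fibre ?leqnn; lia.
  - lia.
  - apply/eqP; rewrite eq_le; apply/andP; split.
      by have := le_run_min (fun n => Ssum n alpha) r 0 isT; rewrite Ssum0.
    apply: run_min_ge => n nr; rewrite first_fibre; last by lia.
    by case: leqP => h; lia.
  - lia.
rewrite ek in kK pos pos' short.
have slow0 : (c 1).-1 = 0%N by rewrite carry1.
have slowS k : ((c k.+1).-1 <= (c k.+2).-1 <= (c k.+1).-1.+1)%N.
  by have := carry_step k.+1; lia.
have VS k : V k.+1 = Ssum (c k.+1).-1 y^-1.
  rewrite fibre_total_even // /Ssum prednK //.
  by have := carry_mono 1 k.+1 isT; rewrite carry1.
have V1 : 0 <= V 1 <= 1 by rewrite VS carry1 Ssum0.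
have ik : i = (c k0.+1).-1.
  have := carry_between j R1; rewrite ek => -> //.
  by rewrite /i /idx_even; lia.
have EM := run_max_slow (fun k => (c k.+1).-1) (fun k => V k.+1)
  (fun m => Ssum m y^-1) k0 slow0 slowS VS.
have Em := run_min_slow (fun k => (c k.+1).-1) (fun k => V k.+1)
  (fun m => Ssum m y^-1) k0 slow0 slowS VS.
have top k : (ups k <= q./2)%N || (V k + (ups k)%:Z <= V k.+1 + (q./2)%:Z).
  rewrite fibre_total (negbTE qe) /ups; have := carry_step k.
  by case: (early_half k) => ck; rewrite ?addn0 ?leqnn //=; lia.
have Mle := hills_max_le s ups downs p fibre_start0 fibre_startS fibre_up
  fibre_down q./2 k0 r ups_le V1 pos.
have Mge := hills_max_ge s ups downs p fibre_start0 fibre_startS fibre_up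
  fibre_down q./2 k0 r downs_ge fibre_length_gt V1 pos.
have Meq := hills_max_eq s ups downs p fibre_start0 fibre_startS fibre_up
  fibre_down q./2 k0 r downs_ge fibre_length_gt V1 pos top.
have meq := hills_min s ups downs p fibre_start0 fibre_startS fibre_up
  fibre_down q./2 k0 r fibre_length_gt V1 pos (fibre_total_ge _).
have DE : D = run_max (fun n => Ssum n alpha) r
    - (run_max (fun k => V k.+1) k0 + (q./2)%:Z).
  by rewrite EM -ik -q2.
split.
- by move=> _; rewrite DE subr_ge0; exact: Mge.
- by rewrite DE lerBlDr addrC; exact: Mle.
- by transitivity (run_min (fun k => V k.+1) k0); [exact: meq | rewrite Em -ik].
- rewrite DE => D1.
  have big : ~~ ((r.+1 - p k0.+1 <= q./2)%N || (ups k0.+1 <= q./2)%N).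
    by apply/negP => /Meq e; move: D1; rewrite -/(Ssum _ _) e subrr.
  move: big; rewrite negb_or -!ltnNge pos' => /andP[bR].
  case R1E : R1 => [|R1'] /= u_gt.
    by split=> //; rewrite q2; move: bR; rewrite R1E /=; lia.
  (* A later hill with a nonempty part is short, and has no extra upward step. *)
  move: u_gt; rewrite /ups early_half_short ?addn0 ?ltnn //.
  by apply: short; move: bR; rewrite R1E /=; lia.
Qed.

(** Case [q] odd, with [y / (1 - y)] in place of [[a_2 - 1, a_3, ...]]. *)
Lemma rotation_odd j R1 R0 (r := (p (K j) + R1 * q + R0)%N) :
  odd q ->
  (R1 * q + R0 < p (K j.+1) - p (K j))%N -> (R0 < q)%N ->
  let i := (K j - j + (R1 - 1))%N in
  let D := maxS r alpha - (1 - minS i (y / (1 - y)) + ((q - 1) %/ 2)%:Z) in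
  [/\ ((q - 1) %/ 2 <= r.+1)%N -> 0 <= D, D <= 1
    & (q <= r)%N -> minS r alpha = 1 - maxS i (y / (1 - y))].
Proof.
set g := y / (1 - y).
move=> qo gap R0q i D.
have [kK pos _ _] := block_position j R1 R0 gap R0q.
rewrite -/r in pos.
have Dge : forall m, (m <= r)%N -> Ssum m alpha <= maxS r alpha.
  exact: (le_run_max (fun n => Ssum n alpha)).
have qq := odd_double_half q; rewrite qo in qq.
have q2 : ((q - 1) %/ 2 = q./2)%N by rewrite divn2; lia.
case ek : (K j + R1)%N => [|k0].
  have [Kj R10] : K j = 0%N /\ R1 = 0%N by lia.
  have j0 : j = 0%N by rewrite -(carry_long j) Kj carry0.
  have i0 : i = 0%N by rewrite /i Kj R10.
  have rR0 : r = R0 by rewrite /r Kj R10 fibre_start0.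
  rewrite /D i0 -[minS 0 _]/(run_min (fun n => Ssum n g) 0) run_min0 Ssum0 q2.
  have rle : maxS r alpha <= (q./2).+1%:Z.
    apply: run_max_le => n nr; rewrite first_fibre; last by lia.
    by case: leqP => h; lia.
  split; [|lia|lia].
  have [/Dge|rb br] := leqP q./2 r; first by rewrite first_fibre ?leqnn; lia.
  by have := Dge r (leqnn r); rewrite first_fibre; [case: leqP|]; lia.
rewrite ek in kK pos.
have slow0 : (1 - c 1 = 0)%N by rewrite carry1.
have slowS k : (k.+1 - c k.+1 <= k.+2 - c k.+2 <= (k.+1 - c k.+1).+1)%N.
  exact: carry_sub_step.
have VS k : V k.+1 = 1 - Ssum (k.+1 - c k.+1) g by exact: fibre_total_odd.
have V1 : 0 <= V 1 <= 1 by rewrite VS carry1 Ssum0.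
have ik : i = (k0.+1 - c k0.+1)%N.
  have jK : (j <= K j)%N by rewrite -{1}(carry_long j) carry_leq.
  have := carry_between j R1; rewrite ek => -> //.
  by rewrite /i; case: (R1) ek => [|?] /=; lia.
have EM := run_max_slow (fun k => k.+1 - c k.+1)%N (fun k => V k.+1)
  (fun m => 1 - Ssum m g) k0 slow0 slowS VS.
have Em := run_min_slow (fun k => k.+1 - c k.+1)%N (fun k => V k.+1)
  (fun m => 1 - Ssum m g) k0 slow0 slowS VS.
rewrite run_max_const_sub -ik in EM; rewrite run_min_const_sub -ik in Em.
have Mle := hills_max_le s ups downs p fibre_start0 fibre_startS fibre_up
  fibre_down q./2 k0 r ups_le V1 pos.
have Mge := hills_max_ge s ups downs p fibre_start0 fibre_startS fibre_up
  fibre_down q./2 k0 r downs_ge fibre_length_gt V1 pos.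
have meq := hills_min s ups downs p fibre_start0 fibre_startS fibre_up
  fibre_down q./2 k0 r fibre_length_gt V1 pos (fibre_total_ge _).
have DE : D = run_max (fun n => Ssum n alpha) r
    - (run_max (fun k => V k.+1) k0 + (q./2)%:Z).
  by rewrite EM -q2.
split.
- by move=> _; rewrite DE subr_ge0; exact: Mge.
- by rewrite DE lerBlDr addrC; exact: Mle.
- by move=> _; rewrite -[RHS]Em; exact: meq.
Qed.

End Fibres.

(** * From the rotation back to continued fractions *)

Lemma Ssum_eq_shift (R : realType) (x y : R) (m : nat) : x = m%:R + y ->
  forall n, Ssum n x = Ssum n y.
Proof. by move=> -> n; exact: Ssum_shift. Qed.

Lemma maxS_shift (R : realType) (x y : R) (m n : nat) : x = m%:R + y ->
  maxS n x = maxS n y.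
Proof.
by move=> xy; apply: (eq_run_max (fun n => Ssum n x)) => l _; exact: Ssum_eq_shift xy l.
Qed.

Lemma minS_shift (R : realType) (x y : R) (m n : nat) : x = m%:R + y ->
  minS n x = minS n y.
Proof.
move=> xy; rewrite -[LHS]/(run_min (fun n => Ssum n x) n).
rewrite -[RHS]/(run_min (fun n => Ssum n y) n).
rewrite !run_min_opp; congr (- _); apply: eq_run_max => l _.
by rewrite (Ssum_eq_shift _ _ _ _ xy).
Qed.

(** [y / (1 - y) = 1 / (1 / y - 1)] and [1 / y - 1 = (a_2 - 1) + alpha_2].  For
    [a_2 = 1] this is [1 / alpha_2 = a_3 + [a_4, a_5, ...]], which explains the
    convention for [[0, a_3, ...]]. *)
Lemma cf_alphabar1E (R : realType) (a : nat -> nat) (y : R)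
  (a_pos : forall h, (0 < h)%N -> (0 < a h)%N) :
  y = cfrac R (fun h => a h.+2) -> 0 < y < 1 ->
  exists m : nat, y / (1 - y) = m%:R + cf_alphabar1 R a.
Proof.
move=> yE y01.
have yE2 : y = ((a 2%N)%:R + cfrac R (fun h => a h.+3))^-1.
  by rewrite yE cfracE // => h; exact: a_pos.
have z1 : y / (1 - y) = (y^-1 - 1)^-1 by field; lra.
rewrite z1 yE2 invrK /cf_alphabar1; case: eqP => [->|a2].
  rewrite addrAC subrr add0r; exists (a 3%N).
  by rewrite cfracE ?invrK // => h; exact: a_pos.
exists 0%N; rewrite add0r [RHS]cfracE /=; last first.
  by case=> [|h]; [by case: (a 2%N) a2 (a_pos 2%N isT) => [|[]] | exact: a_pos].
by rewrite -subn1 natrB ?a_pos // addrAC.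
Qed.

(* The guards on [r] in the conclusion concern only the beginning [r < q1] of
   the first block ([j = R1 = 0]), where the guarded relation is false: there
   all of [S_0, ..., S_r] are positive and the maximum is still growing. *)
Theorem proposition3p1 (R : realType) (alpha : R) (a : nat -> nat)
    (a_pos : forall h, (0 < h)%N -> (0 < a h)%N)
    (alpha_cf : alpha = cf_alpha R a)
    (alpha01 : 0 < alpha < 1)
    (alpha_irr : irrational alpha)
    (r j R1 R0 : nat) :
  let q1 := a 1%N in
  let k := k_ alpha (a 1%N) in
  r = (r_ alpha (k j) + R1 * q1 + R0)%N ->
  (R1 * q1 + R0 < r_ alpha (k j.+1) - r_ alpha (k j))%N ->
  (0 <= R1 <= a 2%N + 1)%N ->
  (0 <= R0 < q1)%N ->
  (~~ odd (a 1%N) ->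
    let i := idx_even j R1 in
    let D := maxS r alpha
             - (maxS i (cf_alpha2 R a) + (a 1%N %/ 2)%:Z) in
    [/\ (a 1%N %/ 2 <= r)%N -> 0 <= D,
        D <= 1,
        minS r alpha = minS i (cf_alpha2 R a)
      & D = 1 -> R1 = 0%N /\ (a 1%N %/ 2 <= R0)%N])
  /\
  (odd (a 1%N) ->
    let i := idx_odd alpha (a 1%N) j R1 in
    let D := maxS r alpha
             - (1 - minS i (cf_alphabar1 R a) + ((a 1%N - 1) %/ 2)%:Z) in
    [/\ ((a 1%N - 1) %/ 2 <= r.+1)%N -> 0 <= D,
        D <= 1
      & (q1 <= r)%N -> minS r alpha = 1 - maxS i (cf_alphabar1 R a)]).
Proof.
pose y := cfrac R (fun h => a h.+2).
have y_irr : irrational y.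
  apply: (irrational_cfrac_tail R (fun h => a h.+1)) => [h|]; first exact: a_pos.
  by rewrite -/(cf_alpha R a) -alpha_cf.
have y01 : 0 < y < 1.
  by apply: irrational_itv01 => //; apply: cfrac_itv => h; exact: a_pos.
have /andP[y0 y1] := y01.
have q0 : (0 < a 1%N)%N by exact: a_pos.
have alphaE : alpha = ((a 1%N)%:R + y)^-1.
  by rewrite alpha_cf /cf_alpha cfracE // => h; exact: a_pos.
have y2 : y^-1 = (a 2%N)%:R + cf_alpha2 R a.
  by rewrite /y cfracE ?invrK // => h; exact: a_pos.
have [m ybar] := cf_alphabar1E R a y a_pos erefl y01.
move=> q1 k; rewrite /idx_odd {}/k alphaE => rE.
rewrite !(r_E, k_E) // in rE * => gap _ /andP[_ R0q].
split=> parity; rewrite rE.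
  have := rotation_even R (a 1%N) y q0 y0 y1 j R1 R0 parity gap R0q.
  by cbv zeta; rewrite (maxS_shift _ _ _ _ _ y2) (minS_shift _ _ _ _ _ y2).
have := rotation_odd R (a 1%N) y q0 y0 y1 y_irr j R1 R0 parity gap R0q.
by cbv zeta; rewrite (maxS_shift _ _ _ _ _ ybar) (minS_shift _ _ _ _ _ ybar).
Qed.
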